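(* Suppose: (1) the parameter space is $\Theta=[\eta_{\min},\eta_{\max}]\times[\theta_{\min},\theta_{\max}]\times[\rho_{\min},\rho_{\max}]\subset(0,1)\times(0,\infty)\times(0,1)$; (2) the true parameter $\phi_0=(\eta_0,\theta_0,\rho_0)$ is in the interior of $\Theta$; (3) the prior density $p$ on $\Theta$ is continuous and satisfies $p(\phi_0)>0$; (4) (persistent excitation) for every $\epsilon>0$ there exists $\kappa(\epsilon)>0$ such that $$\liminf_{T\to\infty}\ \inf_{\phi\in\Theta:\ \|\phi-\phi_0\|\ge\epsilon}\ \frac1T\sum_{t=1}^T \mathrm{KL}\big(p_t(\cdot\mid\phi_0)\,\|\,p_t(\cdot\mid\phi)\big)\ \ge\ \kappa(\epsilon)\quad\text{a.s.}$$ Then the posterior-mean estimator $\hat\phi_T$ is consistent: $\|\hat\phi_T-\phi_0\|\to 0$ almost surely as $T\to\infty$.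
   Context: Notation: $[K]=\{1,\dots,K\}$. There are a fixed number $N\ge1$ of commuters and $M\ge 1$ physical paths; days are $t=1,2,\dots$. The exogenous travel costs $c_t(i)\in\mathbb{R}$, $i\in[M]$, are bounded by a finite constant: $|c_t(i)|\le C$ for all $t,i$. Path $0$ is a virtual ''not traveling'' alternative. Pooled day-to-day choice model. For a parameter $\phi=(\eta,\theta,\rho)$ with $\eta\in(0,1)$, $\theta>0$, $\rho\in(0,1)$, common to all commuters, and exogenously fixed initial perceived costs $V_1(i)\in\mathbb{R}$ (same for all commuters and not depending on $\phi$; for example all zero), perceived costs are updated by $V_{t+1}(i)=(1-\eta)V_t(i)+\eta c_t(i)$, $i\in[M]$. The choice distribution on day $t$ is the probability vector $p_t(\cdot\mid\phi)$ on $\{0,1,\dots,M\}$ with $$p_t(0\mid\phi)=\rho,\qquad p_t(i\mid\phi)=(1-\rho)\frac{e^{-\theta V_t(i)}}{\sum_{m\in[M]}e^{-\theta V_t(m)}},\quad i\in[M].$$ Given the costs, the choices $X_t^n\in\{0,\dots,M\}$ ($n\in[N]$, $t\ge1$) are independent across $n$ and $t$; the data are generated under the true parameter $\phi_0$, i.e. $X_t^n\sim p_t(\cdot\mid\phi_0)$. Almost-sure statements refer to this data-generating law. $\mathrm{KL}(q\|r)=\sum_{x}q(x)\log\frac{q(x)}{r(x)}$ is the Kullback–Leibler divergence; $\|\cdot\|$ is the Euclidean norm. The posterior based on horizon $T$ is the density on $\Theta$ proportional to $p(\phi)\prod_{n=1}^N\prod_{t=1}^T p_t(X_t^n\mid\phi)$,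 and $\hat\phi_T$ is its mean, $\hat\phi_T=\int_\Theta \phi\, p(\phi\mid X_{1:T},c_{1:T})\,d\phi$. *)

(* Defs.v *)
From HB Require Import structures.
From mathcomp Require Import all_boot all_order all_algebra.
From mathcomp Require Import all_classical all_reals all_analysis.

Set Implicit Arguments.
Unset Strict Implicit.
Unset Printing Implicit Defensive.

Import Order.TTheory GRing.Theory Num.Theory.
Import numFieldNormedType.Exports.

Local Open Scope classical_set_scope.
Local Open Scope ring_scope.

(* Conventions.  Days are numbered from 0 here: index t stands for day t + 1.
   Likewise i : 'I_M stands for the path i + 1.  The alternatives {0, 1, ..., M}
   are 'I_M.+1: ord0 is "not traveling", lift ord0 i is the path of i : 'I_M. *)

Section Params.
Context {R : realType}.
Implicit Types phi psi : R * R * R.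

(* A parameter is the triple (eta, theta, rho). *)
Definition eta_of phi : R := phi.1.1.
Definition theta_of phi : R := phi.1.2.
Definition rho_of phi : R := phi.2.

Definition param_box (eta_min eta_max theta_min theta_max rho_min rho_max : R) :
    set (R * R * R) :=
  `[eta_min, eta_max] `*` `[theta_min, theta_max] `*` `[rho_min, rho_max].

(* The library norm on a product is the max norm. *)
Definition euclidean_dist phi psi : R :=
  Num.sqrt ((eta_of phi - eta_of psi) ^+ 2 + (theta_of phi - theta_of psi) ^+ 2 +
            (rho_of phi - rho_of psi) ^+ 2).

(* measurableTypeR R, the domain of lebesgue_measure, is R with its Borel sets. *)
Definition lebesgue3 :
    set (measurableTypeR R * measurableTypeR R * measurableTypeR R) -> \bar R :=
  ((@lebesgue_measure R \x @lebesgue_measure R) \x @lebesgue_measure R)%E.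

HB.instance Definition _ := Measure.on lebesgue3.

Definition is_density (Theta : set (R * R * R)) (f : R * R * R -> R) : Prop :=
  (forall phi, Theta phi -> 0 <= f phi)
  /\ (\int[lebesgue3]_(phi in Theta) (f phi)%:E = 1)%E.

End Params.

Definition KL_div {R : realType} {A : finType} (q r : A -> R) : R :=
  \sum_x q x * ln (q x / r x).

Section ChoiceModel.
Context {R : realType} {M : nat}.
Variables (V1 : 'I_M -> R) (c : nat -> 'I_M -> R).
Implicit Types (phi : R * R * R) (t : nat).

Fixpoint perceived_cost phi t (i : 'I_M) : R :=
  if t is s.+1 then
    (1 - eta_of phi) * perceived_cost phi s i + eta_of phi * c s i
  else V1 i.

Definition choice_prob phi t (x : 'I_M.+1) : R :=
  if unlift ord0 x is Some i then
    (1 - rho_of phi) *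
      (expR (- theta_of phi * perceived_cost phi t i)
       / \sum_(m < M) expR (- theta_of phi * perceived_cost phi t m))
  else rho_of phi.

Definition avg_KL phi0 (T : nat) phi : R :=
  T%:R^-1 * \sum_(t < T) KL_div (choice_prob phi0 t) (choice_prob phi t).

End ChoiceModel.

Section Posterior.
Context {R : realType} {N M : nat}.
Variables (V1 : 'I_M -> R) (c : nat -> 'I_M -> R) (x : 'I_N -> nat -> 'I_M.+1).
Variables (Theta : set (R * R * R)) (prior : R * R * R -> R).

Definition likelihood (T : nat) (phi : R * R * R) : R :=
  \prod_(n < N) \prod_(t < T) choice_prob V1 c phi t (x n t).

Definition posterior (T : nat) (phi : R * R * R) : R :=
  prior phi * likelihood T phi
  / \int[lebesgue3]_(psi in Theta) (prior psi * likelihood T psi).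

Definition posterior_mean (T : nat) : R * R * R :=
  (\int[lebesgue3]_(phi in Theta) (eta_of phi * posterior T phi),
   \int[lebesgue3]_(phi in Theta) (theta_of phi * posterior T phi),
   \int[lebesgue3]_(phi in Theta) (rho_of phi * posterior T phi)).

End Posterior.

Section DataGeneration.
Context {R : realType} {d : measure_display} {Omega : measurableType d}.
Variable P : probability Omega R.

(* f is a version of the conditional probability P(E | G). *)
Definition cond_prob_version (G : set (set Omega)) (E : set Omega)
    (f : Omega -> R) : Prop :=
  (forall B : set R, measurable B -> G (f @^-1` B))
  /\ (forall A, G A -> P (A `&` E) = \int[P]_(w in A) (f w)%:E)%E.

Context {N M : nat}.
Variables (V1 : 'I_M -> R) (c : nat -> 'I_M -> {RV P >-> R}).
Variable X : 'I_N -> nat -> Omega -> 'I_M.+1.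

Definition cost_path (w : Omega) (t : nat) (i : 'I_M) : R := c t i w.

Definition cost_sigma_algebra : set (set Omega) :=
  <<s [set A | exists t i (B : set R), measurable B /\ A = c t i @^-1` B] >>.

(* Conditionally on the whole cost process, the choices X n t are independent
   with laws choice_prob _ _ phi0 t: their joint conditional probabilities
   factorize.  For nonrandom costs this is plain independence. *)
Definition choices_generated_by (phi0 : R * R * R) : Prop :=
  (forall n t x, measurable (X n t @^-1` [set x]))
  /\ forall (T : nat) (x : 'I_N -> 'I_T -> 'I_M.+1),
       cond_prob_version cost_sigma_algebra
         [set w | forall n (t : 'I_T), X n t w = x n t]
         (fun w => \prod_(n < N) \prod_(t < T)
            choice_prob V1 (cost_path w) phi0 t (x n t)).

End DataGeneration.

(* Main.v *)
(* Write KL_t for the divergence of the day-t choice laws at phi0 and phi, and LR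
   for the likelihood ratio of phi against phi0. All choice probabilities are
   Lipschitz in phi on a logarithmic scale, uniformly in the day, the costs and
   the alternative: the recursion for the perceived costs contracts by 1 - eta.
   The ratios of day-t probabilities are therefore bounded, and the Hellinger
   affinity of the day-t laws is at most exp (- a KL_t) for a fixed a > 0. So,
   conditionally on the costs, sqrt LR * exp (a * sum of the KL_t) has expectation
   at most 1; Markov's inequality and Borel-Cantelli bound it by exp (delta T)
   eventually, for every delta > 0. A finite net of Theta, the Lipschitz bound and
   persistent excitation turn this into LR <= exp (- 2 delta T) uniformly outside a
   neighbourhood of phi0, while the Lipschitz bound alone gives
   LR >= exp (- delta T) on a small cube around phi0. Hence the posterior mass of
   the complement of the neighbourhood vanishes. *)

Require Import Defs.
From HB Require Import structures.
From mathcomp Require Import all_boot all_order all_algebra.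
From mathcomp Require Import all_classical all_reals all_analysis.
From mathcomp Require Import measurable_realfun ring lra.

Set Implicit Arguments.
Unset Strict Implicit.
Unset Printing Implicit Defensive.

Import Order.TTheory GRing.Theory Num.Theory.
Import numFieldNormedType.Exports.

Local Open Scope classical_set_scope.
Local Open Scope ring_scope.

(** * Choice probabilities *)

Section ChoiceProbability.
Context {R : realType} {M : nat}.
Implicit Types (c : nat -> 'I_M -> R) (phi psi : R * R * R).

Lemma sum_expR_gt0 (i : 'I_M) (u : 'I_M -> R) : 0 < \sum_(m < M) expR (u m).
Proof. by rewrite (bigD1 i)//= ltr_pwDl ?expR_gt0// sumr_ge0. Qed.

Lemma choice_prob_gt0 (V1 : 'I_M -> R) c phi t x :
  0 < rho_of phi < 1 -> 0 < choice_prob V1 c phi t x.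
Proof.
move=> /andP[r0 r1]; rewrite /choice_prob; case: unliftP => [i _|_] //.
by rewrite mulr_gt0 ?subr_gt0// divr_gt0 ?expR_gt0// sum_expR_gt0.
Qed.

Lemma sum_choice_prob (V1 : 'I_M -> R) c phi t : (0 < M)%N ->
  \sum_x choice_prob V1 c phi t x = 1.
Proof.
move=> M0; rewrite big_ord_recl /choice_prob unlift_none.
under eq_bigr do rewrite liftK.
rewrite -mulr_sumr -mulr_suml mulfV ?mulr1 ?subrKC//.
by rewrite gt_eqF// (sum_expR_gt0 (Ordinal M0)).
Qed.

Lemma measurable_perceived_cost d (T : measurableType d) (V1 : 'I_M -> R)
    (c : T -> nat -> 'I_M -> R) (phi : T -> R * R * R) t i :
  (forall s j, measurable_fun setT (fun w => c w s j)) ->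
  measurable_fun setT (fun w => eta_of (phi w)) ->
  measurable_fun setT (fun w => perceived_cost V1 (c w) (phi w) t i).
Proof.
move=> mc me; elim: t => [|t IH] /=; first exact: measurable_cst.
apply: measurable_funD; apply: measurable_funM => //.
by apply: measurable_funB => //; exact: measurable_cst.
Qed.

(** Costs and parameter both depend on the point, so that the lemma serves for random costs at a
    fixed parameter as well as for a varying parameter along fixed costs. *)
Lemma measurable_choice_prob d (T : measurableType d) (V1 : 'I_M -> R)
    (c : T -> nat -> 'I_M -> R) (phi : T -> R * R * R) t x :
  (forall s j, measurable_fun setT (fun w => c w s j)) ->
  measurable_fun setT (fun w => eta_of (phi w)) ->
  measurable_fun setT (fun w => theta_of (phi w)) ->
  measurable_fun setT (fun w => rho_of (phi w)) ->
  measurable_fun setT (fun w => choice_prob V1 (c w) (phi w) t x).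
Proof.
move=> mc me mt mr; rewrite /choice_prob.
case: (unliftP ord0 x) => [i _|_]//.
have mV j : measurable_fun setT
    (fun w => - theta_of (phi w) * perceived_cost V1 (c w) (phi w) t j).
  apply: measurable_funM; first exact: measurable_funN.
  exact: measurable_perceived_cost.
pose S w := \sum_(m < M)
  expR (- theta_of (phi w) * perceived_cost V1 (c w) (phi w) t m).
have S0 w : 0 < S w by exact: sum_expR_gt0 i _.
have mS : measurable_fun setT S.
  by apply: measurable_sum => j; exact: measurableT_comp.
apply: measurable_funM.
  by apply: measurable_funB => //; exact: measurable_cst.
(* The softmax quotient becomes the exponential of a difference, its denominator being positive. *)
under eq_fun => w do
  rewrite -[X in _ / X]lnK ?posrE ?S0// -expRN -expRD.
apply: measurableT_comp => //; apply: measurable_funB => //.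
exact: measurableT_comp.
Qed.

(** Each update is a convex combination of two numbers in [-B, B]. *)
Lemma perceived_cost_bounded (V1 : 'I_M -> R) c (B : R) phi t i :
  (forall j, `|V1 j| <= B) -> (forall s j, `|c s j| <= B) ->
  0 <= eta_of phi <= 1 -> `|perceived_cost V1 c phi t i| <= B.
Proof.
move=> hV hc /andP[e0 e1]; elim: t => [|t IH] //=.
rewrite (le_trans (ler_normD _ _))// !normrM (ger0_norm e0).
rewrite ger0_norm ?subr_ge0//.
have := hc t i; move: IH.
set a := `|_|; set b := `|_| => ha hb.
rewrite -[leRHS](_ : (1 - eta_of phi) * B + eta_of phi * B = B); last by ring.
by rewrite lerD// ler_wpM2l// subr_ge0.
Qed.

(* The difference of the two recursions contracts by the factor [1 - eta] and is
   forced by at most [2 B |eta - eta'|], whence a bound uniform in [t]. *)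
Lemma perceived_cost_lip (V1 : 'I_M -> R) c (B em : R) phi psi t i :
  (forall j, `|V1 j| <= B) -> (forall s j, `|c s j| <= B) ->
  0 < em <= eta_of phi -> eta_of phi <= 1 -> 0 <= eta_of psi <= 1 ->
  `|perceived_cost V1 c phi t i - perceived_cost V1 c psi t i|
    <= 2 * B / em * `|eta_of phi - eta_of psi|.
Proof.
move=> hV hc /andP[em0 eme] e1 e'.
have B0 : 0 <= B by rewrite (le_trans _ (hV i)).
set K := _ * _.
have K0 : 0 <= K by rewrite !mulr_ge0// invr_ge0 ltW.
elim: t => [|t IH] /=; first by rewrite subrr normr0.
have -> : (1 - eta_of phi) * perceived_cost V1 c phi t i + eta_of phi * c t i -
   ((1 - eta_of psi) * perceived_cost V1 c psi t i + eta_of psi * c t i) =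
   (1 - eta_of phi) * (perceived_cost V1 c phi t i - perceived_cost V1 c psi t i)
   + (eta_of phi - eta_of psi) * (c t i - perceived_cost V1 c psi t i) by ring.
rewrite (le_trans (ler_normD _ _))// !normrM (ger0_norm (x := 1 - _)) ?subr_ge0//.
have hD : `|c t i - perceived_cost V1 c psi t i| <= 2 * B.
  rewrite (le_trans (ler_normB _ _))// mulr_natl mulr2n lerD//.
  exact: perceived_cost_bounded.
(* The bound [K] reproduces itself: the forcing term is at most [em * K], hence at most
   [eta_of phi * K]. *)
apply: (@le_trans _ _ ((1 - eta_of phi) * K + eta_of phi * K)).
  apply: lerD; first by rewrite ler_wpM2l ?subr_ge0.
  rewrite (le_trans (ler_wpM2l _ hD))//.
  have -> : `|eta_of phi - eta_of psi| * (2 * B) = em * K.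
    by rewrite /K; field; rewrite gt_eqF.
  by rewrite ler_wpM2r.
by rewrite le_eqVlt; apply/orP; left; apply/eqP; ring.
Qed.

Definition param_near (delta : R) phi psi :=
  [/\ `|eta_of phi - eta_of psi| <= delta,
      `|theta_of phi - theta_of psi| <= delta &
      `|rho_of phi - rho_of psi| <= delta].

(** Since [m <= b], one has [a <= b + delta <= (1 + delta / m) * b], and [1 + u <= expR u]. *)
Lemma ratio_le_expR (a b delta m : R) : 0 < m <= b ->
  `|a - b| <= delta -> a <= expR (delta / m) * b.
Proof.
move=> /andP[m0 mb] h.
have b0 : 0 < b by exact: lt_le_trans mb.
have d0 : 0 <= delta by exact: le_trans h.
apply: (@le_trans _ _ ((1 + delta / m) * b)); last first.
  by rewrite ler_wpM2r ?expR_ge1Dx// ltW.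
have : delta <= delta / m * b.
  by rewrite mulrAC ler_pdivlMr// ler_wpM2l.
rewrite mulrDl mul1r -lerBlDl; apply: le_trans.
exact: le_trans (ler_norm _) h.
Qed.

(** The sum [B + tM * (2 * B / em)] is a Lipschitz constant of theta V; it counts twice because the
    numerator and the normalising sum of the softmax both move. The two inverses come from the
    factors rho and 1 - rho. *)
Definition choice_lip (B em tM rm rM : R) : R :=
  2 * (B + tM * (2 * B / em)) + (rm^-1 + (1 - rM)^-1).

(** The bound is multiplicative so that it passes to products over days and, through logarithms, to
    divergences. *)
Lemma choice_prob_lip (V1 : 'I_M -> R) c (B em tM rm rM : R) phi psi (delta : R) t x :
  (forall j, `|V1 j| <= B) -> (forall s j, `|c s j| <= B) -> 0 <= B ->
  0 < em -> 0 < rm -> rM < 1 ->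
  em <= eta_of phi <= 1 -> em <= eta_of psi <= 1 ->
  0 <= theta_of phi <= tM ->
  rm <= rho_of psi <= rM ->
  param_near delta phi psi -> rho_of phi <= rM ->
  choice_prob V1 c phi t x
    <= expR (choice_lip B em tM rm rM * delta) * choice_prob V1 c psi t x.
Proof.
move=> hV hc B0 em0 rm0 rM1 /andP[e1 e2] /andP[e3 e4] /andP[t1 t2] /andP[r1 r2].
move=> [h1 h2 h3] r3.
have d0 : 0 <= delta by exact: le_trans h1.
have tM0 : 0 <= tM by exact: le_trans t2.
pose K := B + tM * (2 * B / em).
have K0 : 0 <= K by rewrite addr_ge0// !mulr_ge0// invr_ge0 ltW.
have irm : 0 <= rm^-1 by rewrite invr_ge0 ltW.
have irM : 0 <= (1 - rM)^-1 by rewrite invr_ge0 subr_ge0 ltW.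
have hU i : `|theta_of phi * perceived_cost V1 c phi t i
    - theta_of psi * perceived_cost V1 c psi t i| <= K * delta.
  have -> : theta_of phi * perceived_cost V1 c phi t i
    - theta_of psi * perceived_cost V1 c psi t i =
    (theta_of phi - theta_of psi) * perceived_cost V1 c psi t i +
    theta_of phi * (perceived_cost V1 c phi t i - perceived_cost V1 c psi t i).
    by ring.
  rewrite (le_trans (ler_normD _ _))// !normrM /K mulrDl lerD//.
    rewrite mulrC ler_pM//.
    by apply: perceived_cost_bounded => //; rewrite e4 (le_trans _ e3) ?ltW.
  rewrite (ger0_norm t1) -mulrA ler_pM//.
  apply: le_trans (perceived_cost_lip (em := em) t i hV hc _ _ _) _ => //.
  - by rewrite em0.
  - by rewrite e4 (le_trans _ e3) ?ltW.
  - by rewrite ler_wpM2l// !mulr_ge0// invr_ge0 ltW.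
pose E p i := expR (- theta_of p * perceived_cost V1 c p t i).
have hE i : E phi i <= expR (K * delta) * E psi i.
  rewrite /E -expRD ler_expR; have := hU i; rewrite ler_norml => /andP[? ?].
  by rewrite !mulNr; lra.
have hE' i : E psi i <= expR (K * delta) * E phi i.
  rewrite /E -expRD ler_expR; have := hU i; rewrite ler_norml => /andP[? ?].
  by rewrite !mulNr; lra.
have hr : rho_of phi <= expR (delta / rm) * rho_of psi.
  by apply: ratio_le_expR => //; rewrite rm0.
have hr' : 1 - rho_of phi <= expR (delta / (1 - rM)) * (1 - rho_of psi).
  apply: ratio_le_expR; first by rewrite subr_gt0 rM1 lerB.
  by rewrite -normrN; congr (_ <= _): h3; congr `|_|; ring.
have rp0 : 0 <= rho_of psi by rewrite (le_trans _ r1)// ltW.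
have rp1 : rho_of psi < 1 by rewrite (le_lt_trans r2).
rewrite /choice_prob; case: unliftP => [i _|_]; last first.
  rewrite (le_trans hr)// ler_wpM2r// ler_expR mulrC ler_wpM2r//.
  by rewrite /choice_lip; change (rm^-1 <= 2 * K + (rm^-1 + (1 - rM)^-1)); lra.
rewrite -/(E phi i) -/(E psi i).
have S0 p : 0 < \sum_(m < M) E p m by exact: sum_expR_gt0 i _.
have hS : (\sum_(m < M) E psi m) <= expR (K * delta) * \sum_(m < M) E phi m.
  by rewrite mulr_sumr ler_sum.
have hQ : E phi i / (\sum_(m < M) E phi m)
    <= expR (2 * K * delta) * (E psi i / \sum_(m < M) E psi m).
  rewrite ler_pdivrMr// mulrA mulrAC ler_pdivlMr//.
  rewrite (le_trans (ler_pM _ _ (hE i) hS)) ?expR_ge0 ?(ltW (S0 _))//.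
  rewrite le_eqVlt; apply/orP; left; apply/eqP.
  have -> : expR (2 * K * delta) = expR (K * delta) * expR (K * delta).
    by rewrite -expRD; congr expR; ring.
  by ring.
apply: (@le_trans _ _ ((expR (delta / (1 - rM)) * (1 - rho_of psi)) *
   (expR (2 * K * delta) * (E psi i / \sum_(m < M) E psi m)))).
  rewrite ler_pM//; first by rewrite subr_ge0 (le_trans r3 (ltW rM1)).
  by rewrite divr_ge0 ?expR_ge0 ?(ltW (S0 _)).
rewrite mulrACA -expRD ler_wpM2r//.
  by rewrite mulr_ge0 ?subr_ge0 ?(ltW rp1)// divr_ge0 ?expR_ge0// ltW.
rewrite ler_expR /choice_lip -/K [delta / _]mulrC -mulrDl ler_wpM2r//.
by rewrite [leLHS]addrC lerD2l lerDr.
Qed.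

End ChoiceProbability.

(** * Affinity and divergence *)

Section Hellinger.
Context {R : realType}.

Lemma subr_invr_le_ln (s : R) : 0 < s -> 1 - s^-1 <= ln s.
Proof.
move=> s0; have si : 0 < s^-1 by rewrite invr_gt0.
have : ln (1 + (s^-1 - 1)) <= s^-1 - 1 by apply: le_ln1Dx; lra.
by rewrite subrKC lnV ?posrE// lerNl opprB.
Qed.

(** Here [s] stands for a root of [p / q]. The right side without its last term exceeds [s] by
    [(s - 1) ^+ 2 / 2], while [s ^+ 2 - 1 - 2 * ln s <= (s - 1) ^+ 2 * ((s + 2) / s)]. As
    [(s + 2) / s <= (m + 2) / m], the factor [m / (2 * (m + 2))] is small enough. *)
Lemma le_sub_KL_term (m s : R) : 0 < m -> m <= s ->
  s <= 1 + (s ^+ 2 - 1) / 2 - m / (2 * (m + 2)) * (s ^+ 2 - 1 - 2 * ln s).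
Proof.
move=> m0 ms; have s0 : 0 < s by exact: lt_le_trans ms.
set a := m / _.
have a0 : 0 <= a by rewrite divr_ge0// ?mulr_ge0//; lra.
have h1 : s ^+ 2 - 1 - 2 * ln s <= (s - 1) ^+ 2 * ((s + 2) / s).
  have -> : (s - 1) ^+ 2 * ((s + 2) / s) = s ^+ 2 - 1 - 2 * (1 - s^-1).
    by field; rewrite gt_eqF.
  by rewrite lerB// ler_wpM2l// subr_invr_le_ln.
have h2 : a * ((s + 2) / s) <= 2^-1.
  rewrite /a mulrA ler_pdivrMr// mulrAC ler_pdivrMr; last by lra.
  have : m * (s + 2) <= s * (m + 2) by lra.
  by move=> ?; lra.
have h3 : a * (s ^+ 2 - 1 - 2 * ln s) <= (s - 1) ^+ 2 / 2.
  apply: (le_trans (ler_wpM2l a0 h1)).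
  by rewrite mulrCA ler_wpM2l// sqr_ge0.
rewrite [leLHS](_ : s = 1 + (s ^+ 2 - 1) / 2 - (s - 1) ^+ 2 / 2); last by field.
by rewrite lerB.
Qed.

(** Averaging [le_sub_KL_term] under [q] cancels the terms in [p - q] and bounds the affinity by [1
    - a * KL_div q p <= expR (- (a * KL_div q p))]. The compensating exponential stands inside the
    sum so that it becomes part of a one-day weight. *)
Lemma hellinger_affinity_KL (A : finType) (q p : A -> R) (m : R) : 0 < m ->
  (forall x, 0 < q x) -> (forall x, m ^+ 2 * q x <= p x) ->
  \sum_x q x = 1 -> \sum_x p x = 1 ->
  \sum_x q x * (Num.sqrt (p x / q x) * expR (m / (2 * (m + 2)) * KL_div q p)) <= 1.
Proof.
move=> m0 q0 qp q1 p1; set a := m / _.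
under eq_bigr do rewrite mulrA.
rewrite -mulr_suml -[leRHS](mulVf (lt0r_neq0 (expR_gt0 (a * KL_div q p)))).
rewrite ler_wpM2r ?expR_ge0// -expRN.
apply: (@le_trans _ _ (1 - a * KL_div q p)); last first.
  by rewrite (le_trans _ (expR_ge1Dx _)).
have -> : 1 - a * KL_div q p =
    \sum_x (q x + (p x - q x) / 2 - a * (p x - q x + q x * ln (q x / p x))).
  rewrite big_split/= sumrN -mulr_sumr !big_split/= -mulr_suml big_split/=.
  by rewrite sumrN q1 p1 subrr mul0r add0r addr0.
apply: ler_sum => x _.
have p0 : 0 < p x by rewrite (lt_le_trans _ (qp x))// mulr_gt0// exprn_gt0.
have r0 : 0 < p x / q x by rewrite divr_gt0.
have ms : m <= Num.sqrt (p x / q x).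
  rewrite -(ger0_norm (ltW m0)) -sqrtr_sqr ler_wsqrtr//.
  by rewrite ler_pdivlMr.
have h := ler_wpM2l (ltW (q0 x)) (le_sub_KL_term m0 ms).
apply: (le_trans h).
rewrite sqr_sqrtr ?(ltW r0)//.
have -> : ln (q x / p x) = - (2 * ln (Num.sqrt (p x / q x))).
  rewrite -[q x / p x]invf_div lnV ?posrE//; congr (- _).
  by rewrite -[in LHS](sqr_sqrtr (ltW r0)) lnXn ?sqrtr_gt0// mulr_natl.
rewrite le_eqVlt; apply/orP; left; apply/eqP.
rewrite -/a; set l := ln _; move: a l => a l.
by field; rewrite gt_eqF.
Qed.

End Hellinger.

(** * Almost sure bounds for conditionally independent choices *)

Lemma measure_bigcup_fin_le {R : realType} d (T : measurableType d)
    (mu : {measure set T -> \bar R}) (I : finType) (F : I -> set T) :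
  (forall i, measurable (F i)) ->
  (mu (\bigcup_(i in [set: I]) F i) <= \sum_i mu (F i))%E.
Proof.
move=> mF; have -> : \bigcup_(i in [set: I]) F i = \big[setU/set0]_i F i.
  by rewrite -bigcup_seq; apply: eq_bigcupl; split=> i //= _;
    rewrite mem_index_enum.
elim: (index_enum I) => [|i s IH]; first by rewrite !big_nil measure0.
rewrite !big_cons (le_trans (measureU2 _ _ _))//; first exact: bigsetU_measurable.
exact: leeD2l.
Qed.

Section MarkovBound.
Context {R : realType} {d : measure_display} {Omega : measurableType d}.
Variable P : probability Omega R.
Context {N : nat} {A : finType}.
Variables (gen : set (set Omega)) (q g : Omega -> nat -> A -> R).
Variable X : 'I_N -> nat -> Omega -> A.
Hypothesis gen_measurable : gen `<=` measurable.
Hypothesis measurable_X : forall n t x, measurable (X n t @^-1` [set x]).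
Hypothesis q_ge0 : forall w t x, 0 <= q w t x.
Hypothesis g_ge0 : forall w t x, 0 <= g w t x.
Hypothesis measurable_q : forall t x, measurable_fun setT (fun w => q w t x).
Hypothesis measurable_g : forall t x,
  measurable_fun setT (fun w : g_sigma_algebraType gen => g w t x).
Hypothesis qg_le1 : forall w t, \sum_x q w t x * g w t x <= 1.
Hypothesis X_law : forall (T : nat) (x : 'I_N -> 'I_T -> A),
  cond_prob_version P <<s gen >> [set w | forall n (t : 'I_T), X n t w = x n t]
    (fun w => \prod_(n < N) \prod_(t < T) q w t (x n t)).

(** In the application this is the square root of a likelihood ratio times an exponential of the
    accumulated divergence. *)
Definition prod_weight (T : nat) (w : Omega) : R :=
  \prod_(n < N) \prod_(t < T) g w t (X n t w).

Let sub_meas (B : set Omega) : <<s gen >> B -> measurable B.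
Proof. exact: (smallest_sub (sigma_algebra_measurable Omega) gen_measurable). Qed.

Let measurable_g' t x : measurable_fun setT (fun w : Omega => g w t x).
Proof.
by move=> _ B mB; apply: sub_meas; exact: (measurable_g t x measurableT mB).
Qed.

(** Finite functions form a finite type, and sums of products over them factorise. *)
Let path T := {ffun 'I_N * 'I_T -> A}.
Let path_weight T (x : path T) (w : Omega) : R :=
  \prod_(n < N) \prod_(t < T) g w t (x (n, t)).
Let path_event T (x : path T) : set Omega :=
  [set w | forall n (t : 'I_T), X n t w = x (n, t)].

Let measurable_path_event T (x : path T) : measurable (path_event x).
Proof.
rewrite (_ : path_event x =
  \bigcap_(nt in [set: 'I_N * 'I_T]) (X nt.1 nt.2 @^-1` [set x nt])).
  by apply: fin_bigcap_measurable => // nt _; exact: measurable_X.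
by apply/seteqP; split=> w h; [move=> [n t] _; exact: h|
  move=> n t; exact: (h (n, t) I)].
Qed.

(** The conditional law may be integrated only over events of the sigma-algebra generated by [gen];
    this is why [g] is assumed measurable for it. *)
Let measurable_path_weight T (x : path T) lambda :
  <<s gen >> [set w | lambda <= path_weight x w].
Proof.
have : measurable_fun setT (path_weight x : g_sigma_algebraType gen -> R).
  apply: measurable_prod => n _; apply: measurable_prod => t _.
  exact: measurable_g.
move=> /(_ measurableT `[lambda, +oo[%classic (measurable_itv _)).
rewrite setTI; congr (_ _); apply/seteqP; split=> w /=;
  by rewrite in_itv/= andbT.
Qed.

(** On the event of a given path the random weight is the weight of that path, and there are
    finitely many paths. *)
Let prod_weight_eventE T lambda :
  [set w | lambda <= prod_weight T w] =
  \bigcup_(x in [set: path T])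
    ([set w | lambda <= path_weight x w] `&` path_event x).
Proof.
apply/seteqP; split=> w /=.
  move=> h; exists [ffun nt : 'I_N * 'I_T => X nt.1 nt.2 w] => //; split; last first.
    by move=> n t; rewrite ffunE.
  rewrite /= /path_weight; under eq_bigr do under eq_bigr do rewrite ffunE.
  exact: h.
move=> [x _ [/= h xw]]; rewrite /prod_weight.
by under eq_bigr do under eq_bigr do rewrite xw.
Qed.

Lemma measurable_prod_weight_event T lambda :
  measurable [set w | lambda <= prod_weight T w].
Proof.
rewrite prod_weight_eventE; apply: fin_bigcup_measurable => [|x _].
  exact: finite_finset.
by apply: measurableI => //; exact: sub_meas.
Qed.

Let measurable_path_q T (x : path T) :
  measurable_fun setT (fun w => \prod_(n < N) \prod_(t < T) q w t (x (n, t))).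
Proof.
by apply: measurable_prod => n _; apply: measurable_prod => t _.
Qed.

Let measurable_path_g T (x : path T) : measurable_fun setT (path_weight x).
Proof.
by apply: measurable_prod => n _; apply: measurable_prod => t _.
Qed.

(* As only the laws of the finitely many paths are known, Markov's inequality is
   applied path by path. *)
Lemma prod_weight_markov T lambda : 0 < lambda ->
  (P [set w | (lambda <= prod_weight T w)%R] <= (lambda^-1)%:E)%E.
Proof.
move=> l0.
pose Q (x : path T) w := \prod_(n < N) \prod_(t < T) q w t (x (n, t)).
have Q0 x w : 0 <= Q x w by apply: prodr_ge0 => n _; exact: prodr_ge0.
have W0 x w : 0 <= path_weight x w by apply: prodr_ge0 => n _; exact: prodr_ge0.
have QWl0 x w : 0 <= Q x w * path_weight x w * lambda^-1.
  by rewrite mulr_ge0 ?invr_ge0 ?(ltW l0)// mulr_ge0.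
have li0 : 0 <= lambda^-1 by rewrite invr_ge0 ltW.
have mQW (x : path T) : measurable_fun setT
    (fun w => (Q x w * path_weight x w * lambda^-1)%:E).
  apply/measurable_EFinP; apply: measurable_funM => //.
  by apply: measurable_funM; [exact: measurable_path_q|exact: measurable_path_g].
apply: (@le_trans _ _ (\sum_(x : path T) P
    ([set w | (lambda <= path_weight x w)%R] `&` path_event x))%E).
  rewrite prod_weight_eventE; apply: measure_bigcup_fin_le => x.
  by apply: measurableI => //; exact: sub_meas.
apply: (@le_trans _ _ (\sum_(x : path T)
    \int[P]_w (Q x w * path_weight x w * lambda^-1)%:E)%E).
  apply: lee_sum => x _.
  (* Conditioning replaces the indicator of the path by its conditional probability [Q x]; on the
     event of integration, [1 <= path_weight x w / lambda]. *)
  rewrite (proj2 (X_law (fun n t => x (n, t))))//.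
  apply: (@le_trans _ _ (\int[P]_(w in [set w | (lambda <= path_weight x w)%R])
     (Q x w * path_weight x w * lambda^-1)%:E)%E).
    apply: ge0_le_integral => //.
    - exact: sub_meas.
    - move=> w _; rewrite lee_fin; exact: Q0.
    - apply/measurable_EFinP; apply: measurable_funTS; exact: (measurable_path_q x).
    - exact: measurable_funTS.
    - move=> w /= h; rewrite lee_fin -mulrA; apply: ler_peMr; first exact: Q0.
      by rewrite ler_pdivlMr// mul1r.
  apply: ge0_subset_integral => //; first exact: sub_meas.
  by move=> w _; rewrite lee_fin QWl0.
rewrite -ge0_integral_sum//; last first.
  by move=> x w _; rewrite lee_fin QWl0.
rewrite -[leRHS]mule1 -(@probability_setT _ _ _ P) -integral_cst//.
apply: ge0_le_integral => //.
- by move=> w _; apply: sume_ge0 => x _; rewrite lee_fin QWl0.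
- exact: emeasurable_sum.
move=> w _; rewrite sumEFin lee_fin -mulr_suml ler_piMl//.
(* The sum over all paths of a product over commuters and days is the product of one-day sums, each
   at most 1 by [qg_le1]. *)
pose F (nt : 'I_N * 'I_T) y := q w nt.2 y * g w nt.2 y.
rewrite (eq_bigr (fun x : path T => \prod_nt F nt (x nt))); last first.
  move=> x _; rewrite /Q /path_weight -big_split/=.
  under eq_bigr do rewrite -big_split/=.
  by rewrite pair_bigA; apply: eq_bigr => -[].
rewrite -bigA_distr_bigA/=; apply: prodr_ile1 => nt _.
by rewrite sumr_ge0 ?qg_le1// => *; rewrite mulr_ge0.
Qed.

(** Markov's inequality at level [expR (delta * T%:R)] gives the summable bounds
    [expR (- delta) ^+ T], and Borel-Cantelli applies. *)
Lemma prod_weight_near_lt delta : 0 < delta ->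
  {ae P, forall w, \forall T \near \oo, prod_weight T w < expR (delta * T%:R)}.
Proof.
move=> d0; pose E (T : nat) := [set w | expR (delta * T%:R) <= prod_weight T w].
have mE T : measurable (E T) by exact: measurable_prod_weight_event.
pose z := expR (- delta).
have z0 : 0 < z by exact: expR_gt0.
have z1 : `|z| < 1 by rewrite gtr0_norm// expR_lt1 oppr_lt0.
have PE T : (P (E T) <= (z ^+ T)%:E)%E.
  rewrite (le_trans (prod_weight_markov T (expR_gt0 _)))// lee_fin -expRN.
  by rewrite /z -expRM_natr mulNr.
have E0 : P (lim_sup_set E) = 0%E.
  apply: lim_sup_set_cvg0 => //.
  apply: (@le_lt_trans _ _ (1 * (1 - z)^-1)%:E); last by rewrite ltry.
  apply: lime_le; first by apply: is_cvg_nneseries.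
  apply: nearW => n; apply: (@le_trans _ _ (\sum_(0 <= i < n) (z ^+ i)%:E)%E).
    by apply: lee_sum => i _; exact: PE.
  rewrite sumEFin lee_fin (le_trans _ (geometric_le_lim n _ z0 z1))//.
  by rewrite /series/= le_eqVlt; apply/orP; left; apply/eqP;
    apply: eq_bigr => i _; rewrite mul1r.
exists (lim_sup_set E); split => //.
  by apply: bigcap_measurableType => n _; apply: bigcup_measurable.
move=> w /= nw n _; apply: contrapT => nE; apply: nw.
exists n => // T /= nT; rewrite ltNge; apply/negP => h; apply: nE.
by exists T.
Qed.

End MarkovBound.

Lemma measurable_fun_div_gt0 {R : realType} d (T : measurableType d) (f g : T -> R) :
  (forall w, 0 < f w) -> (forall w, 0 < g w) ->
  measurable_fun setT f -> measurable_fun setT g ->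
  measurable_fun setT (fun w => f w / g w).
Proof.
move=> f0 g0 mf mg.
under eq_fun => w do
  rewrite -[f w]lnK ?posrE ?f0// -[X in _ / X]lnK ?posrE ?g0// -expRN -expRD.
by apply: measurableT_comp => //; apply: measurable_funB; exact: measurableT_comp.
Qed.

Lemma natr_avg_KL {R : realType} {M : nat} (V1 : 'I_M -> R)
    (c : nat -> 'I_M -> R) (phi0 phi : R * R * R) (T : nat) :
  T%:R * avg_KL V1 c phi0 T phi =
  \sum_(t < T) KL_div (choice_prob V1 c phi0 t) (choice_prob V1 c phi t).
Proof.
rewrite /avg_KL; case: T => [|T]; first by rewrite big_ord0 mul0r.
by rewrite mulrA mulfV ?mul1r// pnatr_eq0.
Qed.

(** * Exponential control of one likelihood ratio *)

Section LikelihoodRatio.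
Context {R : realType} {d : measure_display} {Omega : measurableType d}.
Variable P : probability Omega R.
Context {N M : nat}.
Variables (V1 : 'I_M -> R) (c : nat -> 'I_M -> {RV P >-> R}).
Variable X : 'I_N -> nat -> Omega -> 'I_M.+1.
Variables phi0 phi : R * R * R.
Hypothesis M_gt0 : (0 < M)%N.
Hypothesis rho0 : 0 < rho_of phi0 < 1.
Hypothesis rho1 : 0 < rho_of phi < 1.
Hypothesis X_law : choices_generated_by V1 c X phi0.

(** Squaring the eventual bound on [prod_weight] removes the root from the likelihood ratio. It also
    doubles the Hellinger exponent to [m / (m + 2)]; the factor [N%:R] appears because all commuters
    share the same daily divergence. *)
Lemma likelihood_ratio_near_le (m delta : R) : 0 < m -> 0 < delta ->
  (forall w t x, m ^+ 2 * choice_prob V1 (cost_path c w) phi0 t x <=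
                 choice_prob V1 (cost_path c w) phi t x) ->
  {ae P, forall w, \forall T \near \oo,
    likelihood V1 (cost_path c w) (fun n t => X n t w) T phi
    * expR (m / (m + 2) * N%:R * (T%:R * avg_KL V1 (cost_path c w) phi0 T phi))
    <= expR (delta * T%:R)
       * likelihood V1 (cost_path c w) (fun n t => X n t w) T phi0}.
Proof.
move=> m0 d0 pm.
pose gen : set (set Omega) :=
  [set A | exists t i (B : set R), measurable B /\ A = c t i @^-1` B].
pose q w t x := choice_prob V1 (cost_path c w) phi0 t x.
pose p w t x := choice_prob V1 (cost_path c w) phi t x.
pose a := m / (2 * (m + 2)).
pose g w t x := Num.sqrt (p w t x / q w t x) * expR (a * KL_div (q w t) (p w t)).
have q0 w t x : 0 < q w t x by exact: choice_prob_gt0.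
have p0 w t x : 0 < p w t x by exact: choice_prob_gt0.
have mcost d' (T : measurableType d') (psi : R * R * R) t x (f : T -> Omega) :
    (forall s j, measurable_fun setT (fun w => cost_path c (f w) s j)) ->
    measurable_fun setT (fun w => choice_prob V1 (cost_path c (f w)) psi t x).
  by move=> mf; apply: measurable_choice_prob => //; exact: measurable_cst.
have mq t x : measurable_fun setT (fun w => q w t x).
  by apply: (mcost _ _ _ _ _ id) => s j; exact: measurable_funP.
have mgen s j : measurable_fun setT
    (fun w : g_sigma_algebraType gen => cost_path c w s j).
  move=> _ B mB; rewrite setTI; apply: sub_sigma_algebra.
  by exists s, j, B.
have mqg t x : measurable_fun setT (fun w : g_sigma_algebraType gen => q w t x).
  exact: (mcost _ (g_sigma_algebraType gen) _ _ _ id).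
have mpg t x : measurable_fun setT (fun w : g_sigma_algebraType gen => p w t x).
  exact: (mcost _ (g_sigma_algebraType gen) _ _ _ id).
have mg t x : measurable_fun setT (fun w : g_sigma_algebraType gen => g w t x).
  apply: measurable_funM.
    have ms := continuous_measurable_fun (@sqrt_continuous R).
    apply: (measurableT_comp ms).
    exact: measurable_fun_div_gt0.
  apply: measurableT_comp => //; apply: measurable_funM => //.
  apply: measurable_sum => y; apply: measurable_funM => //.
  by apply: measurableT_comp => //; exact: measurable_fun_div_gt0.
(* Half of [delta], because the weight is squared below. *)
have d20 : 0 < delta / 2 by rewrite divr_gt0.
have : {ae P, forall w, \forall T \near \oo,
    prod_weight g X T w < expR (delta / 2 * T%:R)}.
  apply: (@prod_weight_near_lt _ _ _ P N _ gen q g X _ _ _ _ mq mg _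
    (proj2 X_law)) => //.
  - by move=> _ [t [i [B [mB ->]]]]; exact: measurable_funPTI.
  - exact: (proj1 X_law).
  - by move=> *; exact: ltW.
  - by move=> *; rewrite mulr_ge0 ?expR_ge0 ?sqrtr_ge0.
  - move=> w t; apply: hellinger_affinity_KL => //.
    + by move=> x; exact: pm.
    + exact: sum_choice_prob.
    + exact: sum_choice_prob.
apply: filterS => w; apply: filterS => T /ltW hT.
have W0 : 0 <= prod_weight g X T w.
  by do 2 (apply: prodr_ge0 => ? _); rewrite mulr_ge0 ?expR_ge0 ?sqrtr_ge0.
have := ler_pM W0 W0 hT hT.
rewrite -[X in _ <= X -> _]expRD -mulrDl -splitr -!expr2.
have L0 : 0 < likelihood V1 (cost_path c w) (fun n t => X n t w) T phi0.
  by do 2 (apply: prodr_gt0 => ? _); exact: q0.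
rewrite -ler_pdivrMr// => /(le_trans _); apply.
have -> : prod_weight g X T w ^+ 2 =
    (\prod_(n < N) \prod_(t < T) (p w t (X n t w) / q w t (X n t w))) *
    \prod_(n < N) \prod_(t < T) expR (a *+ 2 * KL_div (q w t) (p w t)).
  rewrite -big_split/= /prod_weight -prodrXl; apply: eq_bigr => n _.
  rewrite -big_split/= -prodrXl; apply: eq_bigr => t _.
  rewrite exprMn sqr_sqrtr; last by rewrite ltW// divr_gt0.
  by rewrite -expRM_natr [a * _ * _]mulrAC mulr_natr.
rewrite prodr_const card_ord -expR_sum -mulr_sumr -expRM_natr natr_avg_KL.
have -> : a *+ 2 = m / (m + 2).
  by rewrite /a -mulr_natr; field; rewrite !gt_eqF//= ltr_wpDr.
rewrite le_eqVlt; apply/orP; left; apply/eqP.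
rewrite mulrAC; congr (_ * expR _); last by rewrite mulrAC.
rewrite /likelihood -prodf_div; apply: eq_bigr => n _.
by rewrite -prodf_div.
Qed.

End LikelihoodRatio.

(** * Posterior integrals *)

Section WeightedMean.
Context {R : realType} {d : measure_display} {T : measurableType d}.
Variables (mu : {measure set T -> \bar R}) (D : set T).
Hypothesis mD : measurable D.
Variables (prior L f : T -> R).
Hypothesis prior_ge0 : forall x, D x -> 0 <= prior x.
Hypothesis prior_measurable : measurable_fun D prior.
Hypothesis prior_total : (\int[mu]_(x in D) (prior x)%:E = 1)%E.
Hypothesis L_ge0 : forall x, D x -> 0 <= L x.
Hypothesis L_measurable : measurable_fun D L.
Hypothesis f_measurable : measurable_fun D f.
Variables (K Delta f0 : R).
Hypothesis L_le : forall x, D x -> L x <= K.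
Hypothesis f_near : forall x, D x -> `|f x - f0| <= Delta.

Let integrable_prior : mu.-integrable D (EFin \o prior).
Proof.
apply/integrableP; split; first exact/measurable_EFinP.
rewrite (eq_integral (fun x => (prior x)%:E)) ?prior_total ?ltry// => x.
by rewrite inE => Dx; rewrite /= ger0_norm// prior_ge0.
Qed.

(** Integrability rests on the prior alone: [L] and [f] enter as bounded factors. *)
Let integrable_prior_mul (h : T -> R) (B : R) : measurable_fun D h ->
  (forall x, D x -> `|h x| <= B) ->
  mu.-integrable D (EFin \o (fun x => h x * prior x)).
Proof.
move=> mh hB.
apply: (@le_integrable _ _ _ mu D mD _ (fun x => (B * prior x)%:E)).
- by apply/measurable_EFinP; exact: measurable_funM.
- move=> x Dx; rewrite /= lee_fin !normrM ler_wpM2r//.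
  by rewrite (le_trans (hB x Dx))// ler_norm.
- exact: (integrableZl mD B integrable_prior).
Qed.

Let integrable_prior_L : mu.-integrable D (EFin \o (fun x => prior x * L x)).
Proof.
under eq_fun do rewrite /= mulrC.
apply: (integrable_prior_mul (B := K)) => // x Dx.
by rewrite ger0_norm ?L_ge0 ?L_le.
Qed.

Let D_inhabited : exists x, D x.
Proof.
apply: contrapT => nD; have D0 : D = set0.
  by apply/seteqP; split=> x // Dx; apply: nD; exists x.
by move: prior_total; rewrite D0 integral_set0 => /eqP; rewrite eq_sym onee_eq0.
Qed.

(** Where [f] is within [eta] of [f0], the contribution to the centred integral is at most [eta]
    times the normaliser; elsewhere it is at most [Delta * zeta], the prior having total mass 1.
    Division by the normaliser, which is at least [z], gives the bound. *)
Lemma weighted_mean_near (eta zeta z : R) :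
  0 <= eta -> 0 <= zeta -> 0 < z -> z <= \int[mu]_(x in D) (prior x * L x) ->
  (forall x, D x -> eta < `|f x - f0| -> L x <= zeta) ->
  `|\int[mu]_(x in D)
      (f x * (prior x * L x / \int[mu]_(y in D) (prior y * L y))) - f0|
    <= eta + Delta * zeta / z.
Proof.
move=> eta0 zeta0 z0; set Z := \int[mu]_(x in D) (prior x * L x) => zZ far.
have Z0 : 0 < Z by exact: lt_le_trans zZ.
have [x0 Dx0] := D_inhabited.
have Delta0 : 0 <= Delta by rewrite (le_trans _ (f_near Dx0)).
have ifc (g : T -> R) (B : R) : measurable_fun D g ->
    (forall x, D x -> `|g x| <= B) ->
    mu.-integrable D (EFin \o (fun x => g x * (prior x * L x))).
  move=> mg gB.
  under eq_fun do rewrite /= mulrCA mulrC.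
  apply: (integrable_prior_mul (B := B * K)); first exact: measurable_funM.
  move=> x Dx; rewrite normrM ler_pM//; first exact: gB.
  by rewrite ger0_norm ?L_ge0 ?L_le.
have fB x : D x -> `|f x| <= Delta + `|f0|.
  move=> Dx; rewrite -[f x](subrK f0) (le_trans (ler_normD _ _))// lerD2r.
  exact: f_near.
have if1 := ifc f _ f_measurable fB.
have mfc : measurable_fun D (fun x => f x - f0).
  by apply: measurable_funB => //; exact: measurable_cst.
have if2 := ifc (fun x => f x - f0) _ mfc f_near.
have if3 : mu.-integrable D (EFin \o (fun x => `|f x - f0| * (prior x * L x))).
  apply: (ifc _ Delta); first exact: measurableT_comp.
  by move=> x Dx; rewrite normr_id f_near.
have ie : mu.-integrable D (EFin \o (fun x => eta * (prior x * L x))).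
  exact: (integrableZl mD eta integrable_prior_L).
have iz : mu.-integrable D (EFin \o (fun x => Delta * zeta * prior x)).
  exact: (integrableZl mD (Delta * zeta) integrable_prior).
(* The constant [f0] enters the integral because the weights [prior x * L x / Z] integrate to 1. *)
have -> : \int[mu]_(x in D) (f x * (prior x * L x / Z)) - f0 =
    (\int[mu]_(x in D) ((f x - f0) * (prior x * L x))) / Z.
  under eq_Rintegral do rewrite mulrA.
  rewrite RintegralZr//; under [in RHS]eq_Rintegral do rewrite mulrBl.
  rewrite RintegralB//; last first.
    exact: (integrableZl mD f0 integrable_prior_L).
  by rewrite RintegralZl// -/Z mulrBl mulfK// gt_eqF.
rewrite normrM (gtr0_norm (x := Z^-1)) ?invr_gt0// ler_pdivrMr//.
have h1 : `|\int[mu]_(x in D) ((f x - f0) * (prior x * L x))| <=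
    eta * Z + Delta * zeta.
  apply: (le_trans (le_normr_Rintegral _ _)) => //.
  apply: (@le_trans _ _ (\int[mu]_(x in D)
      (eta * (prior x * L x) + Delta * zeta * prior x))).
    apply: le_Rintegral => //.
    - apply: eq_integrable if3 => // x; rewrite inE => Dx /=.
      by rewrite [in RHS]normrM (ger0_norm (x := prior x * _))// mulr_ge0 ?prior_ge0 ?L_ge0.
    - exact: (integrableD mD ie iz).
    move=> x Dx; rewrite normrM (ger0_norm (x := prior x * _)); last first.
      by rewrite mulr_ge0 ?prior_ge0 ?L_ge0.
    have pL : 0 <= prior x * L x by rewrite mulr_ge0 ?prior_ge0 ?L_ge0.
    have [le_eta|/(far x Dx) Lz] := leP `|f x - f0| eta.
      by rewrite ler_wpDr ?ler_wpM2r// !mulr_ge0// prior_ge0.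
    apply: ler_wpDl; first by rewrite mulr_ge0.
    rewrite mulrCA [leRHS]mulrC ler_wpM2l ?prior_ge0// ler_pM ?f_near//.
    exact: L_ge0.
  rewrite RintegralD// !RintegralZl// -/Z.
  have -> : \int[mu]_(x in D) prior x = 1 by rewrite /Rintegral prior_total.
  by rewrite mulr1.
apply: (le_trans h1); rewrite mulrDl lerD2l mulrAC ler_pdivlMr//.
by rewrite ler_wpM2l// mulr_ge0.
Qed.

(** The integrand is nonnegative, so that its integral can be restricted to [Q], where it is at
    least [b * l]. *)
Lemma weighted_mass_ge (Q : set T) (b l v : R) :
  measurable Q -> Q `<=` D -> 0 <= b -> 0 <= l ->
  (v%:E <= mu Q)%E ->
  (forall x, Q x -> b <= prior x) -> (forall x, Q x -> l <= L x) ->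
  b * l * v <= \int[mu]_(x in D) (prior x * L x).
Proof.
move=> mQ QD b0 l0 vQ bp lL.
rewrite -lee_fin fineK; last exact: integrable_fin_num.
have pL x : D x -> (0 <= (prior x * L x)%:E)%E.
  by move=> Dx; rewrite lee_fin mulr_ge0 ?prior_ge0 ?L_ge0.
have mpL : measurable_fun D (fun x => (prior x * L x)%:E).
  by apply/measurable_EFinP; exact: measurable_funM.
apply: (@le_trans _ _ (\int[mu]_(x in Q) (prior x * L x)%:E)%E); last first.
  exact: ge0_subset_integral.
apply: (@le_trans _ _ (\int[mu]_(x in Q) (b * l)%:E)%E).
  rewrite integral_cst// EFinM lee_wpmul2l// lee_fin mulr_ge0//.
apply: ge0_le_integral => //.
- by move=> x _; rewrite lee_fin mulr_ge0.
- exact: measurable_funS mpL.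
- by move=> x Qx; rewrite lee_fin ler_pM ?bp ?lL.
Qed.

End WeightedMean.

(** * Volume and measurability in the parameter space *)

Section Space3.
Context {R : realType}.

(** By conversion the ball of the product space, displayed as a product of intervals for the product
    measure. *)
Definition cube3 (x : R * R * R) (r : R) : set (R * R * R) :=
  ball x.1.1 r `*` ball x.1.2 r `*` ball x.2 r.

Lemma measurable_cube3 x r :
  measurable (cube3 x r : set (measurableTypeR R * measurableTypeR R * measurableTypeR R)).
Proof.
apply: measurableX; last exact: measurable_ball.
by apply: measurableX; exact: measurable_ball.
Qed.

Lemma lebesgue3_cube3 x r : 0 <= r ->
  lebesgue3 (cube3 x r) = ((r *+ 2) ^+ 3)%:E.
Proof.
move=> r0; rewrite /lebesgue3 /cube3.
have mb (a : R) : measurable (ball a r : set (measurableTypeR R)).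
  exact: measurable_ball.
rewrite [LHS](product_measure1E _ _ (measurableX (mb _) (mb _)) (mb _)).
rewrite [X in (X * _)%E](product_measure1E _ _ (mb _) (mb _)).
have hb (a : R) : (@lebesgue_measure R) (ball a r) = (r *+ 2)%:E.
  exact: lebesgue_measure_ball.
rewrite -[LHS]/(lebesgue_measure (ball x.1.1 r) * lebesgue_measure (ball x.1.2 r) *
  lebesgue_measure (ball x.2 r))%E.
rewrite !hb -!EFinM; congr (_%:E).
by rewrite !exprS expr0 mulr1 mulrA.
Qed.

Lemma rat_near (x r : R) : 0 < r -> exists q : rat, `|x - ratr q| < r.
Proof.
move=> r0; have [|q] := @rat_in_itvoo R (x - r) (x + r); first by lra.
by rewrite in_itv/= => /andP[? ?]; exists q; rewrite ltr_norml; apply/andP; split; lra.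
Qed.

(* [R ^ 3] carries the product of the Borel sigma-algebras, whence the detour
   through rational cubes. *)
Lemma open_measurable3 (U : set (R * R * R)) : open U ->
  measurable (U : set (measurableTypeR R * measurableTypeR R * measurableTypeR R)).
Proof.
move=> oU.
pose cen (q : rat * rat * rat * rat) : R * R * R :=
  (ratr q.1.1.1, ratr q.1.1.2, ratr q.1.2).
pose F q := if `[< cube3 (cen q) (ratr q.2) `<=` U >]
  then cube3 (cen q) (ratr q.2) else set0.
have -> : U = \bigcup_q F q.
  apply/seteqP; split=> [x Ux|x [q _]]; last first.
    by rewrite /F; case: asboolP => // /[apply].
  move: oU; rewrite openE => /(_ _ Ux) /nbhs_ballP[e /= e0 xeU'].
  have {xeU'} xeU : cube3 x e `<=` U by exact: xeU'.
  (* A cube of radius below [e / 2] whose centre is within that radius of [x] contains [x] and lies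
     in the cube of radius [e] around [x]. *)
  have [r /andP[r0 re]] : exists r : rat, 0 < (ratr r : R) < e / 2.
    have [|r] := @rat_in_itvoo R 0 (e / 2); first by rewrite divr_gt0.
    by rewrite in_itv/= => h; exists r.
  have [a ha] := rat_near x.1.1 r0.
  have [b hb] := rat_near x.1.2 r0.
  have [c hc] := rat_near x.2 r0.
  exists (a, b, c, r) => //; rewrite /F asboolT.
    by rewrite /cube3 /= -!ball_normE/=; split; [split|];
       rewrite /= distrC.
  move=> y [[/= y1 y2] y3]; apply: xeU; move: y1 y2 y3.
  rewrite -!ball_normE/= => y1 y2 y3.
  have tri (u v w : R) : `|u - w| < ratr r -> `|w - v| < ratr r -> `|u - v| < e.
    move=> h1 h2; rewrite -[u](subrK w) -addrA (le_lt_trans (ler_normD _ _))//.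
    by rewrite (splitr e) ltrD// (lt_trans _ re).
  rewrite /cube3 -!ball_normE/=.
  by split; [split|]; [exact: tri ha y1|exact: tri hb y2|exact: tri hc y3].
apply: countable_bigcupT_measurable => [|q]; first exact: countableP.
by rewrite /F; case: ifP => _ //; exact: measurable_cube3.
Qed.

(** By continuity within [D], the preimage of an open interval meets [D] in the trace of an open
    set, and open intervals generate the Borel sets. *)
Lemma within_continuous_measurable3 (D : set (R * R * R)) (f : R * R * R -> R) :
  measurable (D : set (measurableTypeR R * measurableTypeR R * measurableTypeR R)) ->
  {within D, continuous f} ->
  measurable_fun
    (D : set (measurableTypeR R * measurableTypeR R * measurableTypeR R)) f.
Proof.
move=> mD /continuousP cf; apply: (measurability _ (RGenOpens.measurableE R)).
move=> _ [_ [a [b ->] <-]].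
have /cf/open_subspaceP[V oV VD] : open (`]a, b[%classic : set R) by exact: interval_open.
rewrite setIC -VD; apply: measurableI => //; exact: open_measurable3.
Qed.

End Space3.

(** * Consistency *)

(** Applied over a finite net, both to the almost sure filter and to the eventual one. *)
Lemma filter_forall_seq {T : Type} (F : set_system T) {FF : Filter F}
    (I : eqType) (s : seq I) (Q : I -> T -> Prop) :
  (forall i, i \in s -> \forall x \near F, Q i x) ->
  \forall x \near F, forall i, i \in s -> Q i x.
Proof.
elim: s => [|i s IH] h; first by apply: filterE => x i; rewrite in_nil.
have hi := h i (mem_head _ _).
have hs : \forall x \near F, forall j, j \in s -> Q j x.
  by apply: IH => j js; apply: h; rewrite in_cons js orbT.
apply: filterS2 hi hs => x Qi Qs j.
by rewrite in_cons => /predU1P[->|/Qs].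
Qed.

(** The lower limit is the supremum of the tail infima, so that some tail infimum already exceeds
    [a]. *)
Lemma limn_einf_near_lt {R : realType} (u : (\bar R)^nat) (a b : R) :
  a < b -> (b%:E <= limn_einf u)%E -> \forall n \near \oo, (a%:E < u n)%E.
Proof.
move=> ab; rewrite limn_einf_lim => bu.
have : (a%:E < limn (einfs u))%E by apply: lt_le_trans bu; rewrite lte_fin.
have /cvg_lim -> // := @cvg_einfs_sup R u.
move=> /ereal_sup_gt[_ [n _ <-]] an.
exists n => // m /= nm; apply: (lt_le_trans an).
by apply: ereal_inf_lbound; exists m.
Qed.

(** * Finite nets and distances in the parameter box *)

Section ParameterSpace.
Context {R : realType}.
Implicit Types phi psi : R * R * R.

Lemma param_nearC (r : R) phi psi : param_near r phi psi -> param_near r psi phi.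
Proof. by case=> *; split; rewrite distrC. Qed.

Lemma param_near_cube3 (r : R) phi psi : cube3 psi r phi -> param_near r psi phi.
Proof.
rewrite /cube3 -!ball_normE /= => -[[/ltW ? /ltW ?] /ltW ?].
by split.
Qed.

(** Compactness: finitely many balls of radius [r] with centres in the interval cover it. *)
Lemma itv_net (a b r : R) : 0 < r ->
  exists2 s : seq R, (forall y, y \in s -> `[a, b]%classic y) &
    forall x, `[a, b]%classic x -> exists2 y, y \in s & `|y - x| <= r.
Proof.
move=> r0; have := @segment_compact _ a b; rewrite compact_cover => cab.
have [||s sab sc] := cab R `[a, b]%classic (fun y => ball y r).
- by move=> y _; exact: ball_open.
- by move=> x abx; exists x => //; exact: ballxx.
exists (finmap.enum_fset s) => [y /sab|x /sc[y /= ys]]; first by rewrite inE.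
by rewrite -ball_normE/= => /ltW h; exists y.
Qed.

(** A product of three interval nets. Its points are kept in the box, where the choice probabilities
    are controlled. *)
Lemma param_box_net (a1 b1 a2 b2 a3 b3 r : R) : 0 < r ->
  exists2 s : seq (R * R * R),
    (forall psi, psi \in s -> param_box a1 b1 a2 b2 a3 b3 psi) &
    forall phi, param_box a1 b1 a2 b2 a3 b3 phi ->
      exists2 psi, psi \in s & param_near r psi phi.
Proof.
move=> r0; have [s1 s1P c1] := itv_net a1 b1 r0.
have [s2 s2P c2] := itv_net a2 b2 r0; have [s3 s3P c3] := itv_net a3 b3 r0.
exists [seq (y12, y3) | y12 <- [seq (y1, y2) | y1 <- s1, y2 <- s2], y3 <- s3].
  move=> psi /allpairsP[[y12 y3] /= [/allpairsP[[y1 y2] /= [? ? ->]] ? ->]].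
  by split; [split; [exact: s1P|exact: s2P]|exact: s3P].
move=> [[x1 x2] x3] [[/= /c1[y1 y1s h1] /c2[y2 y2s h2]] /c3[y3 y3s h3]].
by exists (y1, y2, y3); [do 2 (apply: allpairs_f => //)|split].
Qed.

(** The root of [3 * r ^+ 2] is at most [2 * r]. *)
Lemma euclidean_dist_le (r : R) phi psi : 0 <= r ->
  `|eta_of phi - eta_of psi| <= r -> `|theta_of phi - theta_of psi| <= r ->
  `|rho_of phi - rho_of psi| <= r -> euclidean_dist phi psi <= 2 * r.
Proof.
move=> r0 h1 h2 h3; rewrite /euclidean_dist.
have sq (x : R) : `|x| <= r -> x ^+ 2 <= r ^+ 2.
  by move=> xr; rewrite -real_normK ?num_real// lerXn2r ?nnegrE.
have r2 : 0 <= 2 * r by rewrite mulr_ge0.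
rewrite -(ger0_norm r2) -sqrtr_sqr ler_wsqrtr// exprMn.
have := sq _ h1; have := sq _ h2; have := sq _ h3; have := sqr_ge0 r.
by move: (_ ^+ 2) (_ ^+ 2) (_ ^+ 2) (r ^+ 2) => ? ? ? ?; lra.
Qed.

Lemma coord_le_euclidean_dist phi psi :
  [/\ `|eta_of phi - eta_of psi| <= euclidean_dist phi psi,
      `|theta_of phi - theta_of psi| <= euclidean_dist phi psi &
      `|rho_of phi - rho_of psi| <= euclidean_dist phi psi].
Proof.
rewrite /euclidean_dist; set x := _ - _; set y := _ - _; set z := _ - _.
have := sqr_ge0 x; have := sqr_ge0 y; have := sqr_ge0 z => hz hy hx.
by split; rewrite -sqrtr_sqr ler_wsqrtr//;
  move: (x ^+ 2) (y ^+ 2) (z ^+ 2) hx hy hz => ? ? ?; lra.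
Qed.

End ParameterSpace.

(** * Likelihood bounds along one realisation *)

Section Pathwise.
Context {R : realType} {N M : nat}.
Variables (V1 : 'I_M -> R) (c : nat -> 'I_M -> R) (x : 'I_N -> nat -> 'I_M.+1).
Variables (Theta : set (R * R * R)) (Lc : R).
Implicit Types phi psi : R * R * R.
Hypothesis M_gt0 : (0 < M)%N.
Hypothesis Lc_ge0 : 0 <= Lc.
Hypothesis rho_Theta : forall phi, Theta phi -> 0 < rho_of phi < 1.
Hypothesis lip : forall phi psi r t y, Theta phi -> Theta psi ->
  param_near r phi psi ->
  choice_prob V1 c phi t y <= expR (Lc * r) * choice_prob V1 c psi t y.

Lemma likelihood_gt0 T phi : Theta phi -> 0 < likelihood V1 c x T phi.
Proof.
move=> Tphi; do 2 (apply: prodr_gt0 => ? _).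
by apply: choice_prob_gt0; exact: rho_Theta.
Qed.

Lemma likelihood_lip T phi psi r : Theta phi -> Theta psi ->
  param_near r phi psi ->
  likelihood V1 c x T phi
    <= expR (N%:R * Lc * r * T%:R) * likelihood V1 c x T psi.
Proof.
move=> Tphi Tpsi near; rewrite /likelihood.
have -> : expR (N%:R * Lc * r * T%:R) = \prod_(n < N) \prod_(t < T) expR (Lc * r).
  rewrite !prodr_const !card_ord -!expRM_natr; congr expR; ring.
rewrite -big_split/=; apply: ler_prod => n _; apply/andP; split.
  by apply: prodr_ge0 => t _; rewrite ltW// choice_prob_gt0// rho_Theta.
rewrite -big_split/=; apply: ler_prod => t _; apply/andP; split.
  by rewrite ltW// choice_prob_gt0// rho_Theta.
exact: lip.
Qed.

(** By [lip] the logarithms of the choice probabilities at [phi] and [psi] differ by at most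
    [Lc * r], and averaging under [phi0] preserves this. *)
Lemma sum_KL_lip T phi0 phi psi r : Theta phi0 -> Theta phi -> Theta psi ->
  param_near r phi psi ->
  T%:R * avg_KL V1 c phi0 T phi <= T%:R * avg_KL V1 c phi0 T psi + Lc * r * T%:R.
Proof.
move=> T0 Tphi Tpsi near; rewrite !natr_avg_KL.
have -> : Lc * r * T%:R = \sum_(t < T) Lc * r.
  by rewrite sumr_const card_ord mulr_natr.
rewrite -big_split/=; apply: ler_sum => t _.
(* The constant is spread over the alternatives as a mean under [phi0], to compare the sums term by
   term. *)
have -> : Lc * r = \sum_y choice_prob V1 c phi0 t y * (Lc * r).
  by rewrite -mulr_suml sum_choice_prob// mul1r.
rewrite /KL_div -big_split/=; apply: ler_sum => y _.
have [p0 p1 p2] : [/\ 0 < choice_prob V1 c phi0 t y,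
    0 < choice_prob V1 c phi t y & 0 < choice_prob V1 c psi t y].
  by split; apply: choice_prob_gt0; exact: rho_Theta.
rewrite -mulrDr ler_wpM2l ?(ltW p0)//.
rewrite !ln_div ?posrE// -addrA lerD2l lerNl opprD opprK lerBlDr addrC.
rewrite -[X in _ <= X + _]expRK -lnM ?posrE ?expR_gt0// ler_ln ?posrE ?mulr_gt0 ?expR_gt0//.
by apply: lip => //; exact: param_nearC.
Qed.

(** Excitation is used at [phi] and carried over to the net point [psi], which may be closer to
    [phi0] than [eps]. The exponents add up to at most [((N + alpha) * Lc * r + delta - alpha *
    kappa) * T], hence to at most [(delta + delta - 4 * delta) * T]. *)
Lemma far_likelihood_le T phi0 (s : seq (R * R * R)) (eps r alpha kappa delta : R) :
  Theta phi0 -> 0 <= alpha ->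
  (forall psi, psi \in s -> Theta psi) ->
  (forall phi, Theta phi -> exists2 psi, psi \in s & param_near r psi phi) ->
  (N%:R + alpha) * Lc * r <= delta -> alpha * kappa = 4 * delta ->
  (forall phi, Theta phi -> eps <= euclidean_dist phi phi0 ->
     kappa <= avg_KL V1 c phi0 T phi) ->
  (forall psi, psi \in s -> likelihood V1 c x T psi
     * expR (alpha * (T%:R * avg_KL V1 c phi0 T psi))
     <= expR (delta * T%:R) * likelihood V1 c x T phi0) ->
  forall phi, Theta phi -> eps <= euclidean_dist phi phi0 ->
    likelihood V1 c x T phi
      <= expR (- (2 * delta * T%:R)) * likelihood V1 c x T phi0.
Proof.
move=> T0 a0 sT net r_small akd KL_far LR phi Tphi far.
have [psi ps near] := net _ Tphi; have Tpsi := sT _ ps.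
have h1 := likelihood_lip T Tphi Tpsi (param_nearC near).
have h2 := sum_KL_lip T T0 Tphi Tpsi (param_nearC near).
have h3 := LR _ ps; rewrite -ler_pdivlMr ?expR_gt0// -expRN in h3.
have h4 : kappa * T%:R <= T%:R * avg_KL V1 c phi0 T phi.
  by rewrite mulrC ler_wpM2l// KL_far.
move: (T%:R * avg_KL V1 c phi0 T psi) h2 h3 => u h2 h3.
apply: (le_trans h1); apply: le_trans (ler_wpM2l (expR_ge0 _) h3) _.
rewrite [X in _ * X <= _]mulrAC !mulrA -!expRD ler_wpM2r//.
  by rewrite ltW// likelihood_gt0.
rewrite ler_expR.
have h5 : alpha * (kappa * T%:R) <=
    alpha * (u + Lc * r * T%:R).
  by rewrite ler_wpM2l// (le_trans h4).
have h6 := ler_wpM2r (ler0n R T) r_small.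
by move: h5 h6; rewrite mulrA akd => h5 h6; lra.
Qed.

End Pathwise.

(** * Error of the posterior mean *)

Section PosteriorMean.
Context {R : realType} {N M : nat}.
Variables (V1 : 'I_M -> R) (c : nat -> 'I_M -> R) (x : 'I_N -> nat -> 'I_M.+1).
Variables (Theta : set (R * R * R)) (prior : R * R * R -> R) (phi0 : R * R * R).
Implicit Types phi psi : R * R * R.
Hypothesis measurable_Theta : measurable
  (Theta : set (measurableTypeR R * measurableTypeR R * measurableTypeR R)).
Hypothesis prior_density : is_density Theta prior.
Hypothesis measurable_prior : measurable_fun
  (Theta : set (measurableTypeR R * measurableTypeR R * measurableTypeR R)) prior.

Let measurable_eta_of :
  measurable_fun [set: measurableTypeR R * measurableTypeR R * measurableTypeR R] eta_of.
Proof. exact: (measurableT_comp measurable_fst measurable_fst). Qed.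

Let measurable_theta_of :
  measurable_fun [set: measurableTypeR R * measurableTypeR R * measurableTypeR R] theta_of.
Proof. exact: (measurableT_comp measurable_snd measurable_fst). Qed.

Let measurable_rho_of :
  measurable_fun [set: measurableTypeR R * measurableTypeR R * measurableTypeR R] rho_of.
Proof. exact: measurable_snd. Qed.

Lemma measurable_likelihood T : measurable_fun
  (Theta : set (measurableTypeR R * measurableTypeR R * measurableTypeR R))
  (likelihood V1 c x T).
Proof.
apply: measurable_funTS; do 2 (apply: measurable_prod => ? _).
apply: (@measurable_choice_prob _ _ _ _ V1 (fun=> c) id) => //.
Qed.

(** The far likelihood carries the exponent [- (2 * delta * T%:R)], the normaliser, bounded below
    through the cube, only [- (delta * T%:R)]. In their quotient [l0] cancels and one decaying
    exponential remains. *)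
Lemma posterior_mean_near T (K Delta eps delta l0 r b : R) :
  0 <= eps -> 0 < l0 -> 0 < r -> 0 < b ->
  (forall phi, Theta phi -> 0 <= likelihood V1 c x T phi <= K) ->
  (forall phi, Theta phi -> param_near Delta phi phi0) ->
  (forall phi, Theta phi -> eps <= euclidean_dist phi phi0 ->
    likelihood V1 c x T phi <= expR (- (2 * delta * T%:R)) * l0) ->
  cube3 phi0 r `<=` Theta ->
  (forall phi, cube3 phi0 r phi -> b <= prior phi) ->
  (forall phi, cube3 phi0 r phi ->
    expR (- (delta * T%:R)) * l0 <= likelihood V1 c x T phi) ->
  euclidean_dist (posterior_mean V1 c x Theta prior T) phi0 <=
    2 * (eps + Delta / (b * (r *+ 2) ^+ 3) * expR (- (delta * T%:R))).
Proof.
move=> eps0 l00 r0 b0 LK box far QT bQ lQ.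
have L0 phi : Theta phi -> 0 <= likelihood V1 c x T phi by move=> /LK/andP[].
have LK' phi : Theta phi -> likelihood V1 c x T phi <= K by move=> /LK/andP[].
have T0 : Theta phi0 by apply: QT; split; [split|]; exact: ballxx.
have [Delta0 _ _] := box _ T0.
have {}Delta0 : 0 <= Delta by apply: le_trans Delta0.
have [p0 p1] := prior_density.
have mQ := measurable_cube3 phi0 r.
have mL := measurable_likelihood T.
pose z := b * (expR (- (delta * T%:R)) * l0) * (r *+ 2) ^+ 3.
have z0 : 0 < z by rewrite !mulr_gt0 ?exprn_gt0 ?expR_gt0// mulrn_wgt0.
have zZ : z <= \int[lebesgue3]_(psi in Theta) (prior psi * likelihood V1 c x T psi).
  apply: (weighted_mass_ge measurable_Theta p0 measurable_prior p1 L0 mL LK' mQ QT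
    (ltW b0) _ _ bQ lQ).
  - by rewrite mulr_ge0 ?expR_ge0// ltW.
  - by rewrite -(lebesgue3_cube3 phi0 (ltW r0)) lexx.
have zetaE : Delta / (b * (r *+ 2) ^+ 3) * expR (- (delta * T%:R)) =
    Delta * (expR (- (2 * delta * T%:R)) * l0) / z.
  have -> : expR (- (2 * delta * T%:R)) = expR (- (delta * T%:R)) * expR (- (delta * T%:R)).
    by rewrite -expRD; congr expR; ring.
  rewrite /z; field.
  by rewrite !gt_eqF ?expR_gt0.
(* One argument for the three coordinates: a coordinate off by more than [eps] puts [phi] at
   Euclidean distance at least [eps] from [phi0]. *)
have bound (f : R * R * R -> R) :
    measurable_fun (Theta : set (measurableTypeR R * measurableTypeR R * measurableTypeR R)) f ->
    (forall phi, Theta phi -> `|f phi - f phi0| <= Delta) ->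
    (forall phi, `|f phi - f phi0| <= euclidean_dist phi phi0) ->
    `|\int[lebesgue3]_(phi in Theta)
        (f phi * posterior V1 c x Theta prior T phi) - f phi0|
      <= eps + Delta / (b * (r *+ 2) ^+ 3) * expR (- (delta * T%:R)).
  move=> mf fD fe; rewrite zetaE.
  apply: (weighted_mean_near measurable_Theta p0 measurable_prior p1 L0 mL mf LK'
    fD eps0 _ z0 zZ) => [|phi Tphi /ltW h]; first by rewrite mulr_ge0 ?expR_ge0// ltW.
  by apply: far => //; exact: le_trans h (fe phi).
apply: euclidean_dist_le.
- rewrite addr_ge0// mulr_ge0 ?expR_ge0// divr_ge0// mulr_ge0 ?(ltW b0)//.
  by rewrite exprn_ge0// mulrn_wge0// ltW.
- apply: bound => [|phi /box[]//|phi].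
    exact: measurable_funTS measurable_eta_of.
  by have [] := coord_le_euclidean_dist phi phi0.
- apply: bound => [|phi /box[]//|phi].
    exact: measurable_funTS measurable_theta_of.
  by have [] := coord_le_euclidean_dist phi phi0.
- apply: bound => [|phi /box[]//|phi].
    exact: measurable_funTS measurable_rho_of.
  by have [] := coord_le_euclidean_dist phi phi0.
Qed.

End PosteriorMean.

(** * Almost sure convergence *)

Lemma near_expRN_small {R : realType} (C delta e : R) : 0 <= C -> 0 < delta ->
  0 < e -> \forall T \near \oo, C * expR (- (delta * T%:R)) <= e.
Proof.
move=> C0 d0 e0; near=> T.
rewrite expRN ler_pdivrMr ?expR_gt0//.
(* This threshold suffices because [1 + delta * T%:R <= expR (delta * T%:R)]. *)
have : C / (delta * e) <= T%:R by near: T; exact: nbhs_infty_ger.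
rewrite ler_pdivrMr ?mulr_gt0// => h.
apply: (@le_trans _ _ (e * (1 + delta * T%:R))); first by lra.
by rewrite ler_wpM2l ?(ltW e0)// expR_ge1Dx.
Unshelve. all: by end_near. Qed.

(** At an interior point the neighbourhoods within [D] are the ordinary ones. *)
Lemma continuous_within_near_gt {R : realType} (D : set (R * R * R))
    (f : R * R * R -> R) (x : R * R * R) (b : R) :
  interior D x -> {within D, continuous f} -> b < f x ->
  exists2 r : R, 0 < r & forall y, ball x r y -> D y /\ b < f y.
Proof.
move=> Dx cf bx.
have : \forall y \near x, b < f y.
  have := cf x; rewrite /continuous_at -(nbhs_subspace_interior Dx) => fx.
  exact: (cvgr_gt _ fx).
move=> h; have {}Dx : \forall y \near x, D y by exact: Dx.
have : \forall y \near x, D y /\ b < f y by exact: filterI.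
move=> /nbhs_ballP[r r0 rb].
by exists r => // y /rb[].
Qed.

Theorem theorem2 (R : realType) (d : measure_display) (Omega : measurableType d)
    (P : probability Omega R) (N M : nat) (hN : (1 <= N)%N) (hM : (1 <= M)%N)
    (V1 : 'I_M -> R) (c : nat -> 'I_M -> {RV P >-> R}) (C : R)
    (hc : forall t i w, `|c t i w| <= C)
    (X : 'I_N -> nat -> Omega -> 'I_M.+1)
    (eta_min eta_max theta_min theta_max rho_min rho_max : R)
    (Theta : set (R * R * R))
    (hTheta : Theta = param_box eta_min eta_max theta_min theta_max rho_min rho_max)
    (hTheta_sub : Theta `<=` [set phi : R * R * R |
       [/\ 0 < eta_of phi < 1, 0 < theta_of phi & 0 < rho_of phi < 1]])
    (phi0 : R * R * R) (hphi0 : interior Theta phi0)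
    (hX : choices_generated_by V1 c X phi0)
    (prior : R * R * R -> R) (hprior : is_density Theta prior)
    (hprior_cont : {within Theta, continuous prior})
    (hprior_pos : 0 < prior phi0)
    (hPE : forall epsilon : R, 0 < epsilon ->
       exists2 kappa : R, 0 < kappa &
         {ae P, forall w : Omega,
           (kappa%:E <= limn_einf (fun T : nat =>
             ereal_inf [set (avg_KL V1 (cost_path c w) phi0 T phi)%:E
               | phi in [set phi : R * R * R |
                   Theta phi /\ (epsilon <= euclidean_dist phi phi0)%R]]))%E}) :
  {ae P, forall w : Omega,
    euclidean_dist
      (posterior_mean V1 (cost_path c w) (fun n t => X n t w) Theta prior T) phi0
      @[T --> \oo] --> (0 : R)}.
Proof.
have T0 : Theta phi0 by exact: interior_subset hphi0.
have [[e0lo e0hi] [t0lo t0hi] [r0lo r0hi]] :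
    [/\ eta_min <= eta_of phi0 /\ eta_of phi0 <= eta_max,
        theta_min <= theta_of phi0 /\ theta_of phi0 <= theta_max &
        rho_min <= rho_of phi0 /\ rho_of phi0 <= rho_max].
  move: T0; rewrite hTheta => -[[]] /=.
  by rewrite !in_itv/= => /andP[? ?] /andP[? ?] /andP[? ?].
have inT (e t r : R) : eta_min <= e <= eta_max -> theta_min <= t <= theta_max ->
    rho_min <= r <= rho_max -> Theta (e, t, r).
  by move=> he ht hr; rewrite hTheta; split; [split|]; rewrite /= in_itv.
(* Being nonempty, the box contains its two extreme corners; there [hTheta_sub] yields strict bounds
   valid on all of [Theta]. *)
have /hTheta_sub[/= /andP[em0 _] tm0 /andP[rm0 _]] :
    Theta (eta_min, theta_min, rho_min).
  by apply: inT; rewrite lexx/=; [exact: le_trans e0hi|exact: le_trans t0hi|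
    exact: le_trans r0hi].
have /hTheta_sub[/= /andP[_ eM1] _ /andP[_ rM1]] :
    Theta (eta_max, theta_max, rho_max).
  by apply: inT; rewrite lexx andbT; [exact: le_trans e0hi|exact: le_trans t0hi|
    exact: le_trans r0hi].
rewrite /eta_of/= in em0 eM1; rewrite /theta_of/= in tm0.
rewrite /rho_of/= in rm0 rM1.
have ThetaP phi : Theta phi ->
    [/\ eta_min <= eta_of phi <= eta_max, theta_min <= theta_of phi <= theta_max
      & rho_min <= rho_of phi <= rho_max].
  by rewrite hTheta => -[[]] /=; rewrite !in_itv.
have rhoT phi : Theta phi -> 0 < rho_of phi < 1 by move=> /hTheta_sub[].
have mTheta : measurable
    (Theta : set (measurableTypeR R * measurableTypeR R * measurableTypeR R)).
  rewrite hTheta; apply: measurableX; last exact: measurable_itv.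
  by apply: measurableX; exact: measurable_itv.
(* One bound for the initial perceived costs and for the costs of all days. *)
pose B := `|C| + \sum_(i < M) `|V1 i|.
have hV i : `|V1 i| <= B.
  rewrite /B (bigD1 i)//= addrCA lerDl addr_ge0//.
  by apply: sumr_ge0 => *.
have B0 : 0 <= B by rewrite addr_ge0// sumr_ge0.
have hcB w s i : `|cost_path c w s i| <= B.
  rewrite (le_trans (hc s i w))// (le_trans (ler_norm C))// lerDl.
  exact: sumr_ge0.
pose Lc := choice_lip B eta_min theta_max rho_min rho_max.
have tM0 : 0 <= theta_max by rewrite (le_trans _ t0hi)// (le_trans _ t0lo)// ltW.
have Lc0 : 0 <= Lc.
  rewrite addr_ge0//; last by rewrite addr_ge0// invr_ge0 ?subr_ge0 ltW.
  by rewrite mulr_ge0// addr_ge0// !mulr_ge0// invr_ge0 ltW.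
have lip w phi psi r t y : Theta phi -> Theta psi -> param_near r phi psi ->
    choice_prob V1 (cost_path c w) phi t y
      <= expR (Lc * r) * choice_prob V1 (cost_path c w) psi t y.
  move=> /ThetaP[/andP[p1 p2] /andP[p3 p4] /andP[p5 p6]].
  move=> /ThetaP[/andP[q1 q2] /andP[q3 q4] /andP[q5 q6]] near.
  apply: (choice_prob_lip (B := B)) => //.
  - by rewrite p1 (le_trans p2 (ltW eM1)).
  - by rewrite q1 (le_trans q2 (ltW eM1)).
  - by rewrite p4 (le_trans _ p3)// ltW.
  - by rewrite q5.
pose Delta := (eta_max - eta_min) + (theta_max - theta_min) + (rho_max - rho_min).
have box phi psi : Theta phi -> Theta psi -> param_near Delta phi psi.
  move=> /ThetaP[/andP[p1 p2] /andP[p3 p4] /andP[p5 p6]].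
  move=> /ThetaP[/andP[q1 q2] /andP[q3 q4] /andP[q5 q6]].
  by split; rewrite ler_norml /Delta; apply/andP; split; lra.
have Delta0 : 0 <= Delta by have [h _ _] := box _ _ T0 T0; apply: le_trans h.
(* By the Lipschitz bound across the whole box, [m ^+ 2 = expR (- (Lc * Delta))] is a lower bound
   for all ratios of choice probabilities. *)
pose m := expR (- (Lc * Delta) / 2).
have m0 : 0 < m by exact: expR_gt0.
have ratio_ge w phi t y : Theta phi ->
    m ^+ 2 * choice_prob V1 (cost_path c w) phi0 t y
      <= choice_prob V1 (cost_path c w) phi t y.
  move=> Tphi; rewrite /m -expRM_natr mulfVK// expRN ler_pdivrMl ?expR_gt0//.
  by apply: lip => //; exact: box.
pose alpha := m / (m + 2) * N%:R.
have alpha0 : 0 < alpha.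
  by rewrite mulr_gt0 ?ltr0n// divr_gt0// addr_gt0.
have b0 : 0 < prior phi0 / 2 by rewrite divr_gt0.
have [|r1 r10 r1P] := continuous_within_near_gt (b := prior phi0 / 2) hphi0 hprior_cont.
  by rewrite ltr_pdivrMr// ltr_pMr// ltr1n.
have mprior := within_continuous_measurable3 mTheta hprior_cont.
pose mean w T :=
  posterior_mean V1 (cost_path c w) (fun n t => X n t w) Theta prior T.
have key (e : R) : 0 < e ->
    {ae P, forall w, \forall T \near \oo, euclidean_dist (mean w T) phi0 <= 4 * e}.
  move=> e_gt0; have [kappa kappa0 hPE_e] := hPE _ e_gt0.
  (* The average divergence eventually exceeds [kappa / 2], strictly below the bound on its lower
     limit; the 4 is the one required by [far_likelihood_le]. *)
  pose delta := alpha * (kappa / 2) / 4.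
  have delta0 : 0 < delta by rewrite divr_gt0// mulr_gt0// divr_gt0.
  (* The added 1 keeps [G] positive even when [Lc] is 0. *)
  pose G := (N%:R + alpha) * Lc + 1.
  have G0 : 0 < G by rewrite ltr_wpDl// mulr_ge0// addr_ge0// ltW.
  pose r := Num.min r1 (delta / G).
  have r0 : 0 < r by rewrite lt_min r10 divr_gt0.
  have rG : r * G <= delta by rewrite -ler_pdivlMr// ge_min lexx orbT.
  have r_net : (N%:R + alpha) * Lc * r <= delta.
    apply: le_trans rG; have -> : r * G = (N%:R + alpha) * Lc * r + r.
      by rewrite /G; ring.
    by rewrite lerDl ltW.
  have r_cube : N%:R * Lc * r <= delta.
    apply: le_trans r_net; rewrite ler_wpM2r ?(ltW r0)// ler_wpM2r//.
    by rewrite lerDl ltW.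
  have [s sT net] := param_box_net eta_min eta_max theta_min theta_max rho_min rho_max r0.
  rewrite -hTheta in sT net.
  (* Neither [r] nor the net depends on the realisation, so that only finitely many null sets are
     discarded. *)
  have LR : {ae P, forall w, forall psi, psi \in s -> \forall T \near \oo,
      likelihood V1 (cost_path c w) (fun n t => X n t w) T psi
      * expR (alpha * (T%:R * avg_KL V1 (cost_path c w) phi0 T psi))
      <= expR (delta * T%:R)
         * likelihood V1 (cost_path c w) (fun n t => X n t w) T phi0}.
    apply: filter_forall_seq => psi ps.
    apply: likelihood_ratio_near_le => //.
    - exact: rhoT.
    - by apply: rhoT; exact: sT.
    - by move=> w t y; apply: ratio_ge; exact: sT.
  apply: filterS2 hPE_e LR => w hinf hLR.
  have k2 : kappa / 2 < kappa by rewrite ltr_pdivrMr// ltr_pMr// ltr1n.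
  have h1 := limn_einf_near_lt k2 hinf.
  have h2 := @filter_forall_seq _ _ eventually_filter _ s _ hLR.
  have z0 : 0 <= Delta / (prior phi0 / 2 * (r *+ 2) ^+ 3).
    by rewrite divr_ge0// mulr_ge0 ?(ltW b0)// exprn_ge0// mulrn_wge0// ltW.
  have h3 := near_expRN_small z0 delta0 e_gt0.
  near=> T.
  have g1 : ((kappa / 2)%:E < ereal_inf [set (avg_KL V1 (cost_path c w) phi0 T phi)%:E
    | phi in [set phi | Theta phi /\ (e <= euclidean_dist phi phi0)%R]])%E by near: T.
  have g2 : forall psi, psi \in s ->
      likelihood V1 (cost_path c w) (fun n t => X n t w) T psi
      * expR (alpha * (T%:R * avg_KL V1 (cost_path c w) phi0 T psi))
      <= expR (delta * T%:R)
         * likelihood V1 (cost_path c w) (fun n t => X n t w) T phi0 by near: T.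
  have g3 : Delta / (prior phi0 / 2 * (r *+ 2) ^+ 3) * expR (- (delta * T%:R)) <= e.
    by near: T.
  have cubeP phi : cube3 phi0 r phi -> Theta phi /\ prior phi0 / 2 < prior phi.
    move=> h; apply: r1P; have : cube3 phi0 r1 phi; last by [].
    have rr1 : r <= r1 by rewrite ge_min lexx.
    by case: h => [[x1 x2] x3]; split; [split|]; exact: le_ball rr1 _ _.
  apply: (@le_trans _ _ (2 * (e + e))); last by lra.
  (* The value of [K] bounds the likelihood over all of [Theta]; it does not enter the estimate. *)
  apply: (le_trans (posterior_mean_near (b := prior phi0 / 2) (r := r)
    (delta := delta) (eps := e)
    (K := expR (N%:R * Lc * Delta * T%:R) *
       likelihood V1 (cost_path c w) (fun n t => X n t w) T phi0)
    (l0 := likelihood V1 (cost_path c w) (fun n t => X n t w) T phi0)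
    mTheta hprior mprior (ltW e_gt0) _ r0 b0 _ (fun phi Tphi => box _ _ Tphi T0)
    _ _ _ _)).
  - exact: (likelihood_gt0 _ _ _ rhoT).
  - move=> phi Tphi; rewrite ltW ?(likelihood_gt0 _ _ _ rhoT)//=.
    by apply: (likelihood_lip _ rhoT (lip w)) => //; exact: box.
  - apply: (far_likelihood_le (kappa := kappa / 2) hM rhoT (lip w) T0
      (ltW alpha0) sT net r_net _ _ g2).
      by rewrite /delta [RHS]mulrC divfK.
    move=> phi Tphi far; rewrite -lee_fin (le_trans (ltW g1))//.
    by apply: ereal_inf_lbound; exists phi.
  - by move=> phi /cubeP[].
  - by move=> phi /cubeP[_ /ltW].
  - move=> phi cphi; have [Tphi _] := cubeP _ cphi.
    rewrite expRN ler_pdivrMl ?expR_gt0//.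
    have near := param_near_cube3 cphi.
    apply: (le_trans (likelihood_lip _ rhoT (lip w) T T0 Tphi near)).
    rewrite ler_wpM2r ?(ltW (likelihood_gt0 _ _ _ rhoT _ _))// ler_expR.
    by rewrite ler_wpM2r.
  by rewrite ler_wpM2l// lerD2l.
(* Countably many tolerances suffice, so that a single null set serves for all of them. *)
have : {ae P, forall w, forall k : nat, \forall T \near \oo,
    euclidean_dist (mean w T) phi0 <= 4 * k.+1%:R^-1}.
  by apply: ae_foralln => k; apply: key; rewrite invr_gt0.
apply: filterS => w hw; apply/cvgr0Pnorm_le => e e0.
have [k hk] : exists k : nat, 4 / e <= k.+1%:R.
  have [k _ /(_ k (leqnn k)) hk] := @nbhs_infty_ger R (4 / e).
  by exists k; rewrite (le_trans hk)// ler_nat.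
apply: filterS (hw k) => T hT.
rewrite ger0_norm ?sqrtr_ge0// (le_trans hT)// ler_pdivrMr//.
by rewrite mulrC -ler_pdivrMr.
Unshelve. all: by end_near. Qed.
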